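(* Let $n$ be an even integer, $n>4$, and let $G_t(x)=x^{2^t-1}$ over $\mathbb{F}_{2^n}$ for $t=\frac n2$. Then $G_t$ is locally-APN. More precisely, $$\delta(G_t)=2^t-2\quad\text{and}\quad \delta(b)\le 2\ \text{ for all } b\in\mathbb{F}_{2^n}\setminus\mathbb{F}_2 .$$ Moreover, the differential spectrum of $G_t$ is: - if $n\equiv 0\bmod 4$: $\omega_{2^t-2}=1$; $\omega_i=0$ for all $i$ with $2<i<2^t-2$; $\omega_2=2^{n-1}-2^{t-1}+1$; $\omega_0=2^{n-1}+2^{t-1}-2$; - if $n\equiv 2\bmod 4$: $\omega_{2^t-2}=1$; $\omega_i=0$ for all $i$ with $4<i<2^t-2$; $\omega_4=1$; $\omega_2=2^{n-1}-2^{t-1}-1$; $\omega_0=2^{n-1}+2^{t-1}-1$.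
   Context: For $b\in\mathbb{F}_{2^n}$, $\delta(b)=\#\{x\in\mathbb{F}_{2^n} : G_t(x+1)+G_t(x)=b\}$, and $\delta(G_t)=\max_{b\in\mathbb{F}_{2^n}}\delta(b)$ is the differential uniformity. The differential spectrum is the family $\omega_i=\#\{b\in\mathbb{F}_{2^n} : \delta(b)=i\}$. $G_t$ is called locally-APN if $\delta(b)\le 2$ for all $b\in\mathbb{F}_{2^n}\setminus\mathbb{F}_2$. *)

(* Defs.v *)
From mathcomp Require Import all_boot all_algebra.

Set Implicit Arguments.
Unset Strict Implicit.
Unset Printing Implicit Defensive.

Import GRing.Theory.

Local Open Scope ring_scope.

Definition G (F : finFieldType) (t : nat) (x : F) : F := x ^+ (2 ^ t - 1)%N.

(* The difference is taken in direction 1 only, as is usual for power maps;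
   the sign is the characteristic-2 one. *)
Definition delta (F : finFieldType) (f : F -> F) (b : F) : nat :=
  #|[set x : F | f (x + 1) + f x == b]|.

Definition diff_uniformity (F : finFieldType) (f : F -> F) : nat :=
  (\max_(b : F) delta f b)%N.

Definition omega (F : finFieldType) (f : F -> F) (i : nat) : nat :=
  #|[set b : F | delta f b == i]|.

(* The elements of the prime subfield when F has characteristic 2. *)
Definition F2 (F : finFieldType) : {set F} := [set 0; 1].

Definition locally_APN (F : finFieldType) (f : F -> F) : Prop :=
  forall b : F, b \notin F2 F -> (delta f b <= 2)%N.

(* Main.v *)
(* Put q = 2^t, so that F has q^2 elements and x |-> x^q is an involution. For x
   outside F_2, G(x+1) + G(x) = (x^q + x) / (x^2 + x), while for x in F_2 it is 1.
   Hence b = 0 is hit exactly by the elements of F_q outside F_2, and b = 1 by the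
   solutions of x^q = x^2, which all lie in F_4. For any other b the trace
   x^q + x is determined by b, hence so is x^2 + x, so the solutions form a single
   pair {x, x+1} or there are none. The spectrum follows by counting elements of F. *)
Require Import Defs.
From mathcomp Require Import all_boot all_algebra all_field.
From mathcomp Require Import ring zify.

Set Implicit Arguments.
Unset Strict Implicit.
Unset Printing Implicit Defensive.

Import GRing.Theory.

Local Open Scope ring_scope.

(** * Fixed points of power maps on a finite field *)

(** ['X^#|F| - 'X] is the product of the distinct factors X - a over all a in F, so a divisor is, up
    to a scalar, the product over a subset of F. *)
Lemma card_roots_dvd_genPoly (F : finFieldType) (p : {poly F}) :
  p %| 'X^#|F| - 'X -> #|[set x | root p x]| = (size p).-1.
Proof.
rewrite finField_genPoly => /dvdp_prod_XsubC[m eq_p].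
rewrite (eqp_size eq_p) size_prod_XsubC /=.
have /card_uniqP <- : uniq (mask m (index_enum F)).
  by rewrite mask_uniq ?index_enum_uniq.
by apply: eq_card => x; rewrite inE (eqp_root eq_p) root_prod_XsubC.
Qed.

Lemma dvdp_Xexp_subX (R : fieldType) (q m : nat) :
  ('X^q - 'X : {poly R}) %| 'X^(q ^ m) - 'X.
Proof.
elim: m => [|m IHm]; first by rewrite subrr dvdp0.
rewrite expnSr exprM -[X in _ %| X](subrKA 'X^q) dvdp_add ?dvdpp //.
by apply: dvdp_trans IHm _; rewrite subrXX dvdp_mulr.
Qed.

(** Applied below to count the subfields of orders 2^t, 4 and 2. *)
Lemma card_fixed_expf (F : finFieldType) (q m : nat) :
  (1 < q)%N -> #|F| = (q ^ m)%N -> #|[set x : F | x ^+ q == x]| = q.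
Proof.
move=> q_gt1 cardF.
have size_p : size ('X^q - 'X : {poly F}) = q.+1.
  by rewrite size_polyDl size_polyXn // size_polyN size_polyX ltnS.
have := @card_roots_dvd_genPoly F ('X^q - 'X).
rewrite cardF size_p => /(_ (dvdp_Xexp_subX _ _ _)) /= cardR.
by rewrite -[RHS]cardR; apply: eq_card => x; rewrite !inE rootE !hornerE subr_eq0.
Qed.

Lemma sum_delta (F : finFieldType) (f : F -> F) :
  (\sum_(b : F) delta f b = #|F|)%N.
Proof.
rewrite -sum1_card [RHS](partition_big (fun x => f (x + 1) + f x) xpredT) //=.
by apply: eq_bigr => b _; rewrite sum1dep_card.
Qed.

(** * The derivative of [G t] in characteristic 2 *)

Section HalfExponent.

Variables (F : finFieldType) (t : nat).
Hypotheses (cardF : #|F| = (2 ^ t.*2)%N) (t_gt2 : (2 < t)%N).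

Let q := (2 ^ t)%N.

Lemma pchar2 : 2%N \in [pchar F].
Proof. exact: card_finPcharP cardF _. Qed.

Lemma q_gt7 : (7 < q)%N.
Proof. by rewrite (@leq_exp2l 2 3). Qed.

Lemma addrrF (x : F) : x + x = 0.
Proof. exact: addrr_pchar2 pchar2 x. Qed.

Lemma addr_eq0F (x y : F) : (x + y == 0) = (x == y).
Proof. by rewrite addr_eq0 oppr_pchar2 // pchar2. Qed.

Lemma addrK1 (x : F) : x + 1 + 1 = x.
Proof. by rewrite -addrA addrrF addr0. Qed.

Lemma exprDq (x y : F) : (x + y) ^+ q = x ^+ q + y ^+ q.
Proof.
apply: exprDn_pchar.
by rewrite (eq_pnat _ (pcharf_eq pchar2)) pnatX pnat_id.
Qed.

Lemma exprqK (x : F) : x ^+ q ^+ q = x.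
Proof. by rewrite -exprM -expnD addnn -cardF expf_card. Qed.

Lemma mem_F2 (x : F) : (x \in F2 F) = (x ^+ 2 + x == 0).
Proof.
rewrite !inE (_ : x ^+ 2 + x = x * (x + 1)); last by ring.
by rewrite mulf_eq0 addr_eq0F.
Qed.

Lemma GE (x : F) : x != 0 -> G t x = x ^+ q / x.
Proof.
move=> x0; apply: (mulIf x0); rewrite divfK // /G -exprSr.
by congr (_ ^+ _); have := q_gt7; rewrite /q; lia.
Qed.

Lemma G0 : G t (0 : F) = 0.
Proof.
rewrite /G expr0n (_ : (2 ^ t - 1 == 0)%N = false) //.
by have := q_gt7; rewrite /q; lia.
Qed.

Lemma G1 : G t (1 : F) = 1.
Proof. exact: expr1n. Qed.

Lemma DG_F2 (x : F) : x \in F2 F -> G t (x + 1) + G t x = 1.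
Proof.
by rewrite !inE => /orP[]/eqP->; rewrite ?addrrF ?add0r ?G0 ?G1 ?addr0 ?add0r.
Qed.

Lemma DG_eq (b x : F) : x \notin F2 F ->
  (G t (x + 1) + G t x == b) = (x ^+ q + x == b * (x ^+ 2 + x)).
Proof.
rewrite !inE negb_or => /andP[x0 x1].
have x1' : x + 1 != 0 by rewrite addr_eq0F.
have sq0 : x ^+ 2 + x != 0.
  by rewrite (_ : _ + _ = x * (x + 1)); [rewrite mulf_neq0 | ring].
rewrite !GE // exprDq expr1n -(inj_eq (mulIf sq0)); congr (_ == _).
(* Clearing denominators leaves a doubled term, zero in characteristic 2. With it written out, the
   identity holds in every field and [field] can prove it. *)
transitivity (x ^+ q + x + (x ^+ q * x + x ^+ q * x)); last first.
  by rewrite addrrF addr0.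
by field; rewrite x0 x1'.
Qed.

(** * Fibres of the derivative *)

Lemma delta0 : delta (@G F t) 0 = (2 ^ t - 2)%N.
Proof.
have cardK : #|[set x : F | x ^+ q == x]| = q.
  apply: (@card_fixed_expf F q 2); first exact: leq_trans q_gt7.
  by rewrite cardF -expnM muln2.
have sub2 : F2 F \subset [set x : F | x ^+ q == x].
  apply/subsetP => x; rewrite !inE => /orP[]/eqP->; rewrite ?expr1n //.
  by rewrite expr0n; have := q_gt7; case: q.
have card2 : #|F2 F| = 2%N by rewrite cards2 eq_sym oner_eq0.
transitivity #|[set x : F | x ^+ q == x] :\: F2 F|.
  2: by rewrite cardsDS // cardK card2.
apply: eq_card => x.
rewrite in_setD; have [xF2|xF2] := boolP (x \in F2 F).
  by rewrite inE DG_F2 // oner_eq0.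
by rewrite inE DG_eq // mul0r addr_eq0F inE.
Qed.

Lemma delta1E : delta (@G F t) 1 = #|[set x : F | x ^+ q == x ^+ 2]|.
Proof.
apply: eq_card => x; rewrite !in_set.
have [xF2|xF2] := boolP (x \in F2 F).
  rewrite DG_F2 // eqxx; move: xF2; rewrite !inE.
  case/orP=> /eqP->; rewrite ?expr1n ?eqxx //.
  by rewrite !expr0n; have := q_gt7; case: q => //= *; rewrite eqxx.
by rewrite DG_eq // mul1r (inj_eq (addIr x)).
Qed.

(** Squaring twice fixes such an [x], so only the parity of the t squarings matters. *)
Lemma expr_q_fixed4 (x : F) : x ^+ 4 = x -> x ^+ q = x ^+ (2 ^ odd t).
Proof.
move=> x4; rewrite /q -{1}(odd_double_half t) expnD exprM.
set y := x ^+ _; have y4 : y ^+ 4 = y by rewrite /y exprAC x4.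
by elim: t./2 => [|k IHk]; rewrite // doubleS -(addn2 k.*2) expnD exprM IHk.
Qed.

Lemma expr_q_sqr (x : F) : x ^+ q = x ^+ 2 -> x ^+ 4 = x.
Proof.
move=> xq; rewrite -[RHS]exprqK xq -exprM mulnC exprM xq -exprM //.
Qed.

(** On F_4 the q-power map is squaring for odd t, so all of F_4 solves x^q = x^2. For even t it is
    the identity, which leaves x = x^2. *)
Lemma delta1 : delta (@G F t) 1 = (if odd t then 4 else 2)%N.
Proof.
rewrite delta1E; have [t_odd|t_even] := ifP.
  rewrite -[RHS](@card_fixed_expf F 4 t) //; last first.
    by rewrite cardF -muln2 mulnC expnM.
  apply: eq_card => x; rewrite !inE; apply/eqP/eqP; first exact: expr_q_sqr.
  by move/expr_q_fixed4; rewrite t_odd.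
rewrite -[RHS](@card_fixed_expf F 2 t.*2) //; apply: eq_card => x; rewrite !inE.
apply/eqP/eqP => [xq|x2].
  by rewrite -xq (expr_q_fixed4 (expr_q_sqr xq)) t_even expr1.
have x4 : x ^+ 4 = x by rewrite (exprM x 2 2) !x2.
by rewrite (expr_q_fixed4 x4) t_even expr1 x2.
Qed.

(* [T = x ^+ q + x] is fixed by the [q]-power map, so raising [T = b (x ^+ 2 + x)]
   to the power [q] and cancelling [T != 0] determines [T], hence [x ^+ 2 + x]. *)
Lemma DG_trace (b x : F) : b \notin F2 F ->
  G t (x + 1) + G t x = b ->
  x ^+ 2 + x = (b ^- q + b^-1 + 1) / b.
Proof.
move=> bF2 DGx; have [b0 b1] : b != 0 /\ b != 1.
  by apply/andP; rewrite -negb_or -!in_set1 -in_setU.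
have [xF2|xF2] := boolP (x \in F2 F).
  by rewrite -DGx DG_F2 // eqxx in b1.
move/eqP: DGx; rewrite DG_eq // => /eqP.
set T := _ + x => Tdef; have B0 : b ^+ q != 0 by rewrite expf_neq0.
have T0 : T != 0 by rewrite Tdef mulf_neq0 // -mem_F2.
have Tq : T ^+ q = T by rewrite /T exprDq exprqK addrC.
have xq : x ^+ q = T + x by rewrite /T -addrA addrrF addr0.
have eqS : x ^+ 2 + x = T / b by rewrite Tdef mulrC mulKf.
rewrite eqS; congr (_ / _).
(* Since x^q = T + x, the q-th power of x^2 + x is (T + x)^2 + (T + x), that is T/b + T^2 + T. *)
have : T = b ^+ q * (T / b + T ^+ 2 + T).
  rewrite -{1}Tq {1}Tdef exprMn exprDq exprAC xq -eqS; congr (_ * _).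
  transitivity (x ^+ 2 + x + T ^+ 2 + T + (x * T + x * T)); first by ring.
  by rewrite addrrF addr0.
move=> eqT; have : b ^- q = b^-1 + T + 1.
  apply: (mulfI B0); apply: (mulfI T0).
  by rewrite divff // mulr1 {1}eqT; field.
move=> ->; transitivity (T + (b^-1 + b^-1) + (1 + 1)); last by ring.
by rewrite !addrrF !addr0.
Qed.

(** An equation encoding that the value is 0 or 2, in a form that can be summed over [b]. *)
Lemma delta_outside (b : F) : b \notin F2 F ->
  delta (@G F t) b = (2 * (delta (@G F t) b == 2))%N.
Proof.
move=> bF2; rewrite /delta; set S := [set x | _].
have [-> | [x xS]] := set_0Vmem S; first by rewrite cards0.
suff -> : S = [set x; x + 1].
  by rewrite cards2 -subr_eq0 opprD addNKr oppr_eq0 oner_eq0.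
have DGx : G t (x + 1) + G t x = b by apply/eqP; move: xS; rewrite inE.
apply/setP => y; rewrite !inE; apply/idP/idP => [/eqP DGy|].
  (* In characteristic 2 this product is the sum of x^2 + x and y^2 + y, which are equal by
     [DG_trace]. *)
  have : (x + y) * (x + y + 1) == 0.
    rewrite (_ : _ * _ = (x ^+ 2 + x) + (y ^+ 2 + y) + (x * y + x * y)).
      by rewrite (DG_trace bF2 DGx) (DG_trace bF2 DGy) !addrrF.
    by ring.
  by rewrite mulf_eq0 addrAC !addr_eq0F ![_ == y]eq_sym.
by case/orP => /eqP->; rewrite ?addrK1 ?DGx // addrC DGx.
Qed.

(** * Counting and the spectrum *)

Lemma sum_F2 (h : F -> nat) :
  (\sum_(b : F) h b = h 0%R + h 1%R + \sum_(b | b \notin F2 F) h b)%N.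
Proof.
rewrite (bigID (mem (F2 F))) /= big_setU1 ?big_set1 //.
by rewrite inE eq_sym oner_eq0.
Qed.

Lemma omega_sum (f : F -> F) (i : nat) :
  omega f i = (\sum_(b : F) (delta f b == i))%N.
Proof. by rewrite /omega -sum1dep_card big_mkcond. Qed.

Let N := (\sum_(b : F | b \notin F2 F) (delta (@G F t) b == 2))%N.

(** Counts the arguments x by their fibres; with [delta1] this determines [N]. *)
Lemma card_F_delta :
  (2 ^ t.*2 = (2 ^ t - 2) + delta (@G F t) 1%R + 2 * N)%N.
Proof.
rewrite -cardF -(sum_delta (@G F t)) sum_F2 delta0; congr addn.
by rewrite big_distrr; apply: eq_bigr => b /delta_outside.
Qed.

(** Counts the values b instead: the 2 stands for b = 0 and b = 1, whose fibres are nonempty, and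
    any other b has fibre size 0 or 2. *)
Lemma card_F_omega0 : (2 ^ t.*2 = omega (@G F t) 0 + 2 + N)%N.
Proof.
rewrite -cardF -sum1_card sum_F2 omega_sum sum_F2 delta0 delta1.
have -> : (2 ^ t - 2 == 0)%N = false by have := q_gt7; rewrite /q; lia.
have -> : ((if odd t then 4 else 2) == 0)%N = false by case: ifP.
rewrite !add0n [RHS]addnAC -big_split [RHS]addnC; congr addn.
by apply: eq_bigr => b /delta_outside; case: eqP => [->|_ ->].
Qed.

Lemma omega2 : omega (@G F t) 2 = (~~ odd t + N)%N.
Proof.
rewrite omega_sum sum_F2 delta0 delta1.
have -> : (2 ^ t - 2 == 2)%N = false by have := q_gt7; rewrite /q; lia.
by case: ifP.
Qed.

Lemma omega_gt2 (i : nat) : (2 < i)%N ->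
  omega (@G F t) i = ((2 ^ t - 2 == i) + (delta (@G F t) 1%R == i))%N.
Proof.
move=> i_gt2; rewrite omega_sum sum_F2 delta0 [X in (_ + X)%N]big1 ?addn0 //.
by move=> b /delta_outside; lia.
Qed.

Lemma delta_le2 (b : F) : b \notin F2 F -> (delta (@G F t) b <= 2)%N.
Proof. by move=> /delta_outside ->; case: eqP. Qed.

(** The maximum is attained at b = 0: all other fibres have at most 4 elements, while 2^t - 2 is at
    least 6. *)
Lemma diff_uniformity_G : diff_uniformity (@G F t) = (2 ^ t - 2)%N.
Proof.
apply/eqP; rewrite eqn_leq -{2}delta0 (leq_bigmax (0 : F)) andbT.
apply/bigmax_leqP => b _; have := q_gt7; rewrite /q => q_gt.
have [|/delta_le2] := boolP (b \in F2 F); last by lia.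
by rewrite !inE => /orP[]/eqP->; rewrite ?delta0 ?delta1 //; case: ifP; lia.
Qed.

End HalfExponent.

Local Close Scope ring_scope.

Theorem theorem7 (F : finFieldType) (n t : nat)
    (cardF : #|F| = 2 ^ n) (n_even : ~~ odd n) (n_gt4 : 4 < n)
    (t_def : t = n./2) :
  [/\ locally_APN (@G F t),
      diff_uniformity (@G F t) = 2 ^ t - 2
        /\ (forall b : F, b \notin F2 F -> delta (@G F t) b <= 2),
      n = 0 %[mod 4] ->
        [/\ omega (@G F t) (2 ^ t - 2) = 1,
            forall i : nat, 2 < i < 2 ^ t - 2 -> omega (@G F t) i = 0,
            omega (@G F t) 2 = 2 ^ n.-1 - 2 ^ t.-1 + 1
          & omega (@G F t) 0 = 2 ^ n.-1 + 2 ^ t.-1 - 2]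
    & n = 2 %[mod 4] ->
        [/\ omega (@G F t) (2 ^ t - 2) = 1,
            forall i : nat, 4 < i < 2 ^ t - 2 -> omega (@G F t) i = 0,
            omega (@G F t) 4 = 1,
            omega (@G F t) 2 = 2 ^ n.-1 - 2 ^ t.-1 - 1
          & omega (@G F t) 0 = 2 ^ n.-1 + 2 ^ t.-1 - 1]].
Proof.
have [n_dbl t_gt2] : n = t.*2 /\ 2 < t.
  by rewrite t_def; have := odd_double_half n; lia.
have cardF' : #|F| = 2 ^ t.*2 by rewrite cardF n_dbl.
have locAPN := delta_le2 cardF' t_gt2.
have q_gt := q_gt7 t_gt2.
have d1 := delta1 cardF' t_gt2.
have sumd := card_F_delta cardF' t_gt2.
have sum0 := card_F_omega0 cardF' t_gt2.
have w2 := omega2 cardF' t_gt2.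
have wi := omega_gt2 cardF' t_gt2.
(* With 2^(t-1) and 2^(n-1) as atoms, the two counting identities are linear and [lia] can solve for
   the spectrum. *)
have qE : 2 ^ t = 2 * 2 ^ t.-1 by rewrite -expnS prednK // (ltn_trans _ t_gt2).
have q2E : 2 ^ t.*2 = 2 * 2 ^ n.-1 by rewrite -expnS n_dbl prednK //; lia.
have q2lt : 2 ^ t <= 2 ^ n.-1 by rewrite leq_exp2l //; lia.
split=> // [|n0|n2].
- by split=> //; apply: diff_uniformity_G.
- have t_even : odd t = false by lia.
  rewrite t_even in d1 w2; rewrite d1 in sumd wi.
  by split=> [|i i_bd||]; first [lia | rewrite wi; lia].
- have t_odd : odd t by lia.
  rewrite t_odd in d1 w2; rewrite d1 in sumd wi.
  by split=> [|i i_bd|||]; first [lia | rewrite wi; lia].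
Qed.
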